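(* Let $n\ge 2$, let $G$ be a $2$-transitive group of permutations of $X=\{1,\dots,n\}$, let $E$ be a real Euclidean vector space with orthonormal basis $(e_1,\dots,e_n)$, and let $\mathcal{J}:G\to G\ltimes \Pi^n$ be a group homomorphism of the form $\mathcal{J}(\sigma)=(\sigma,\nu^\sigma)$ for all $\sigma\in G$, where $\nu^\sigma=(\nu^\sigma_1,\dots,\nu^\sigma_n)\in\Pi^n$. Then: 1. There is a unique linear representation $\rho:G\to GL(E)$ such that $\rho_\sigma(e_j)=\nu^\sigma_j\, e_{\sigma(j)}$ for all $\sigma\in G$ and $j\in X$. 2. Consider the symmetric $n\times n$ matrices $\mathcal{E}=(\varepsilon_{i,j})$ with zero main diagonal and all off-diagonal coefficients in $\{-1,+1\}$ such that $$(\ast)\qquad \varepsilon_{\sigma(i),\sigma(j)}=\nu^\sigma_i\,\nu^\sigma_j\,\varepsilon_{i,j}\quad\text{for all }\sigma\in G,\ i,j\in X.$$ The number of such matrices is $0$ or $2$; if $\mathcal{E}$ is one of them, the other is $-\mathcal{E}$. 3. If the representation $\rho:G\to GL(E)$ is not irreducible (over $\mathbb{R}$), then: (a) there exists a matrix $\mathcal{E}$ as in part 2 satisfying $(\ast)$; (b) this matrix has exactly two (distinct) eigenvalues $\lambda_1$ and $\lambda_2$; (c) the associated eigenspaces $E_1$ and $E_2$ (eigenspaces in $E$ of the endomorphism with matrix $\mathcal{E}$ in the basis $(e_1,\dots,e_n)$) are irreducible $G$-submodules of $E$, on each of which $G$ induces a doubly transitive representation.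
   Context: $\Pi^n=\{\nu=(\nu_1,\dots,\nu_n): \nu_j=\pm1 \text{ for all } j\}$ is a group under componentwise multiplication. For $\nu\in\Pi^n$ and a permutation $\sigma$ of $X$, put $\nu_\sigma=(\nu_{\sigma(1)},\dots,\nu_{\sigma(n)})$. The group $G$ acts on $\Pi^n$ by automorphisms $\theta_\sigma(\nu)=\nu_{\sigma^{-1}}$, and $G\ltimes\Pi^n$ is the corresponding semidirect product, whose elements are written $(\sigma,\nu)$ (or $\sigma\nu$) with multiplication $(\sigma,\nu)(\delta,\mu)=(\sigma\delta,\ \nu_\delta\,\mu)$. Doubly transitive representation: a linear representation $\gamma$ of a permutation group $G$ on $X=\{1,\dots,n\}$ in a real vector space $V$ is called doubly transitive if there are nonzero vectors $v_1,\dots,v_n\in V$ such that (1) $v_1,\dots,v_n$ span $V$, and (2) $\langle\gamma_\sigma(v_i)\rangle=\langle v_{\sigma(i)}\rangle$ for all $i\in X$, $\sigma\in G$, where $\langle v\rangle$ denotes the line spanned by $v$. (The definition does not require the lines $\langle v_i\rangle$ to be pairwise distinct.) *)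

(* Defs.v *)
From HB Require Import structures.
From mathcomp Require Import all_boot all_order all_algebra all_fingroup.
From mathcomp Require Import all_solvable.
From mathcomp Require Import all_classical all_reals.

Set Implicit Arguments.
Unset Strict Implicit.
Unset Printing Implicit Defensive.

Import Order.TTheory GRing.Theory Num.Theory.

Local Open Scope ring_scope.

(* The composite [sigma o delta] (apply [delta] first).  The group law of
   [{perm T}] composes in the opposite order: [(s * t) i = t (s i)]. *)
Definition perm_comp (T : finType) (sigma delta : {perm T}) : {perm T} :=
  (delta * sigma)%g.

Section SemidirectProduct.
Variables (R : realType) (n : nat).

Definition is_sign_vector (nu : {ffun 'I_n -> R}) : Prop :=
  forall j, nu j = 1 \/ nu j = -1.

Definition in_semidirect (G : {group {perm 'I_n}})
    (x : {perm 'I_n} * {ffun 'I_n -> R}) : Prop :=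
  x.1 \in G /\ is_sign_vector x.2.

(* (sigma, nu) (delta, mu) = (sigma delta, nu_delta mu) *)
Definition semidirect_mul (x y : {perm 'I_n} * {ffun 'I_n -> R}) :
    {perm 'I_n} * {ffun 'I_n -> R} :=
  (perm_comp x.1 y.1, [ffun j => x.2 (y.1 j) * y.2 j]).

(* Only the values of [J] on [G] matter. *)
Definition semidirect_morphism (G : {group {perm 'I_n}})
    (J : {perm 'I_n} -> {perm 'I_n} * {ffun 'I_n -> R}) : Prop :=
  (forall sigma, sigma \in G -> in_semidirect G (J sigma)) /\
  {in G &, {morph J : s t / perm_comp s t >-> semidirect_mul s t}}.

End SemidirectProduct.

Section Representations.
Variables (R : realType) (n : nat) (G : {group {perm 'I_n}}).

(* Invertibility of the [rho sigma] follows from the two conditions; the values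
   of [rho] outside [G] are irrelevant. *)
Definition linear_repr (V : vectType R) (rho : {perm 'I_n} -> 'End(V)) : Prop :=
  rho 1%g = \1%VF /\
  {in G &, forall s t, rho (perm_comp s t) = (rho s \o rho t)%VF}.

Definition stable_subspace (V : vectType R) (rho : {perm 'I_n} -> 'End(V))
    (U : {vspace V}) : Prop :=
  {in G, forall s, (rho s @: U <= U)%VS}.

Definition irreducible_repr (V : vectType R) (rho : {perm 'I_n} -> 'End(V)) :
    Prop :=
  (0 < \dim {:V})%N /\
  forall U : {vspace V}, stable_subspace rho U -> U = 0%VS \/ U = fullv.

Definition doubly_transitive_repr (V : vectType R)
    (gamma : {perm 'I_n} -> 'End(V)) : Prop :=
  linear_repr gamma /\
  exists v : 'I_n -> V,
    [/\ forall i, v i != 0,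
        <<[seq v i | i : 'I_n]>>%VS = fullv
      & forall s i, s \in G -> <[gamma s (v i)]>%VS = <[v (s i)]>%VS].

(* The restriction of [rho] to [U]; it is only meaningful when [U] is stable,
   since [vsproj U] is a linear projection that is the identity on [U]. *)
Definition sub_repr (V : vectType R) (rho : {perm 'I_n} -> 'End(V))
    (U : {vspace V}) (s : {perm 'I_n}) : 'End(subvs_of U) :=
  (linfun (vsproj U) \o (rho s \o linfun vsval))%VF.

End Representations.

Section Matrices.
Variables (R : realType) (n : nat).

Definition compatible_matrix (G : {group {perm 'I_n}})
    (nu : {perm 'I_n} -> {ffun 'I_n -> R}) (A : 'M[R]_n) : Prop :=
  [/\ A^T = A,
      forall i, A i i = 0,
      forall i j, i != j -> A i j = 1 \/ A i j = -1
    & forall s i j, s \in G -> A (s i) (s j) = nu s i * nu s j * A i j].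

Section Endomorphism.
Variables (E : vectType R) (e : n.-tuple E).

Definition mx_endo_fun (A : 'M[R]_n) (u : E) : E :=
  \sum_j coord e j u *: (\sum_i A i j *: tnth e i).

Lemma mx_endo_fun_linear A : linear (mx_endo_fun A).
Proof.
move=> a u v; rewrite /mx_endo_fun scaler_sumr -big_split /=.
by apply: eq_bigr => j _; rewrite linearP scalerDl scalerA.
Qed.

HB.instance Definition _ A := GRing.isSemilinear.Build R _ _ _ (mx_endo_fun A)
  (GRing.semilinear_linear (mx_endo_fun_linear A)).

(* The library's [passmx.hommx] requires a basis of type [(\dim E).-tuple E]
   and lets matrices act on row vectors; here columns are images of the basis
   vectors, see [mx_endoE]. *)
Definition mx_endo (A : 'M[R]_n) : 'End(E) := linfun (mx_endo_fun A).

Lemma mx_endoE A j :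
  basis_of {:E} e -> mx_endo A (tnth e j) = \sum_i A i j *: tnth e i.
Proof.
move=> /basis_free e_free; rewrite lfunE /= /mx_endo_fun.
have eE k : coord e k (tnth e j) = (j == k)%:R.
  by rewrite (tnth_nth 0) coord_free // eq_sym.
rewrite (bigD1 j) //= eE eqxx scale1r [X in _ + X]big1 ?addr0 // => k kj.
by rewrite eE eq_sym (negPf kj) scale0r.
Qed.

End Endomorphism.
End Matrices.

(* Main.v *)
Require Import Defs.
From HB Require Import structures.
From mathcomp Require Import all_boot all_order all_algebra all_fingroup.
From mathcomp Require Import all_solvable.
From mathcomp Require Import all_classical all_reals.

Set Implicit Arguments.
Unset Strict Implicit.
Unset Printing Implicit Defensive.

Import Order.TTheory GRing.Theory Num.Theory.

Local Open Scope classical_set_scope.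
Local Open Scope card_scope.
Local Open Scope ring_scope.

(**
   The representation is orthogonal, so for a stable subspace [U] the orthogonal
   projection onto [U] commutes with [G] and its matrix [P] is symmetric and
   satisfies the covariance relation of compatible matrices.  By 2-transitivity
   such a matrix has the form [a + b A] with [A] compatible.  If [U] is proper
   and nonzero then [P] is not scalar, so [b != 0] and [A = (P - a) / b] has
   exactly two eigenspaces, [U] and its orthogonal complement.  On an
   eigenspace of [A] the projection onto any stable subspace of it is scalar,
   which gives irreducibility; projecting [e] to the eigenspace gives the doubly
   transitive system of vectors.
*)

(** * Transitivity on points and on ordered pairs of distinct points *)

Lemma ntransitive2_exists (T : finType) (G : {group {perm T}})
    (hG : [transitive^2 G, on [set: T]%SET | 'P]) (i j k l : T) :
  i != j -> k != l -> exists s, [/\ s \in G, s i = k & s j = l].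
Proof.
move=> ij kl.
have dt (x y : T) : x != y -> [tuple x; y] \in 2.-dtuple([set: T]%SET).
  by move=> xy; rewrite inE /= inE xy /=; apply/fintype.subsetP=> z; rewrite inE.
have [s sG E] := atransP2 hG (dt _ _ ij) (dt _ _ kl).
have := congr1 val E => /= -[-> ->].
by exists s.
Qed.

Lemma ntransitive_exists (m : nat) (T : finType) (G : {group {perm T}})
    (hG : [transitive^m.+1 G, on [set: T]%SET | 'P]) (i j : T) :
  exists2 s, s \in G & s i = j.
Proof.
have tr := ntransitive1 (ltn0Sn m) hG.
have [s sG ->] := atransP2 tr (finset.in_setT i) (finset.in_setT j).
by exists s.
Qed.

(** * Orthogonal complements and orthogonal projections *)

Section OrthogonalProjection.
Variables (R : realFieldType) (E : vectType R) (dot : {dot E for idfun}).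
Implicit Types (u v w : E) (U : {vspace E}).

Lemma dotC u v : dot u v = dot v u.
Proof. by rewrite hermC expr0 mul1r. Qed.

Lemma dot_eq0 u : (dot u u == 0) = (u == 0).
Proof.
have [->|u0] := eqVneq u 0; first by rewrite linear0r eqxx.
by rewrite gt_eqF // neq0_dnorm_gt0.
Qed.

Lemma capv_orthov U : (U :&: orthov dot U)%VS = 0%VS.
Proof.
apply/eqP; rewrite -subv0; apply/subvP=> u /memv_capP[uU /mem_orthovP ou].
by rewrite memv0 -dot_eq0 ou.
Qed.

(** Each vector added to [X] lowers the dimension of the orthogonal complement by at most one. *)
Lemma dim_orthov_span (X : seq E) :
  (\dim {:E} <= \dim (orthov dot <<X>>) + size X)%N.
Proof.
elim: X => [|x X IH] /=; first by rewrite span_nil orthov0 addn0.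
have sub : (orthov dot <<X>> :&: orthov dot <[x]> <= orthov dot <<x :: X>>)%VS.
  by rewrite span_cons orthovD capvSl capvSr.
have /leq_trans/(_ (dimvS sub)) := leq_dim_orthov1 dot x (orthov dot <<X>>).
move=> h; apply: leq_trans IH _; rewrite addnS -addSn leq_add2r.
(* The bound [h] involves a truncated predecessor, so dimension 0 is split off. *)
by case: (\dim _) h.
Qed.

(** The sum is direct by definiteness of [dot], and [dim_orthov_span] applied to a basis of [U]
    makes its dimension large enough. *)
Lemma addv_orthov U : (U + orthov dot U)%VS = fullv.
Proof.
apply/eqP; rewrite eqEdim subvf /= dimv_disjoint_sum ?capv_orthov // addnC.
have := dim_orthov_span (vbasis U).
by rewrite (span_basis (vbasisP U)) size_tuple.
Qed.

Definition orthoproj U : 'End(E) := daddv_pi U (orthov dot U).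

Lemma memv_orthoproj U u : orthoproj U u \in U.
Proof. exact: memv_pi. Qed.

Lemma orthoproj_id U u : u \in U -> orthoproj U u = u.
Proof. by apply: daddv_pi_id; apply: capv_orthov. Qed.

Lemma orthoproj_residue U u : u - orthoproj U u \in orthov dot U.
Proof.
have {1}<- : orthoproj U u + daddv_pi (orthov dot U) U u = u.
  by apply: daddv_pi_add; rewrite ?capv_orthov // addv_orthov memvf.
by rewrite addrC addKr memv_pi.
Qed.

Lemma orthoproj_unique U u w :
  w \in U -> u - w \in orthov dot U -> orthoproj U u = w.
Proof.
move=> wU uw; apply/eqP; rewrite -subr_eq0 -memv0 -(capv_orthov U) memv_cap.
rewrite memvB ?memv_orthoproj //= -[X in X \in _]opprK opprB.
(* The difference [orthoproj U u - w] equals [(u - w) - (u - orthoproj U u)]. *)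
rewrite -[w - _](subrKA u) -(opprB u w) addrC memvN.
by rewrite memvB ?orthoproj_residue.
Qed.

(** Both sides equal the product of the two projections, because the residues are orthogonal to
    [U]. *)
Lemma orthoproj_sym U u v : dot (orthoproj U u) v = dot u (orthoproj U v).
Proof.
have h x y : dot (orthoproj U x) y = dot (orthoproj U x) (orthoproj U y).
  have : dot (y - orthoproj U y) (orthoproj U x) = 0.
    exact: (mem_orthovP (orthoproj_residue U y) _ (memv_orthoproj U x)).
  by rewrite [dot (y - _) _]dotC linearB => /eqP; rewrite subr_eq0 => /eqP.
by rewrite h [RHS]dotC [RHS]h dotC.
Qed.

(** Orthogonality is recorded only between an element and the later ones, so symmetry of [dot] first
    reduces to [i <= j]. *)
Lemma orthonormal_nth (X : seq E) i j :
  orthonormal dot X -> (i < size X)%N -> (j < size X)%N ->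
  dot X`_i X`_j = (i == j)%:R.
Proof.
move=> /andP[/allP X1 Xo].
wlog le : i j / (i <= j)%N.
  by move=> H; case: (leqP i j) => [|/ltnW] le hi hj;
    [|rewrite dotC eq_sym]; apply: H.
move=> hi hj; have [->|ij] := eqVneq i j; first by apply/eqP/X1/mem_nth.
have {ij}le : (i < j)%N by rewrite ltn_neqAle ij.
elim: X i j Xo le hi hj {X1} => //= x X IH [|i] [|j] //= /andP[xX Xo] le hi hj.
  move: xX; rewrite /ortho_rec /= ?andbT => /allP x_ortho.
  by apply/eqP; apply: (x_ortho X`_j); apply: mem_nth.
exact: IH.
Qed.

End OrthogonalProjection.

(** * Matrices satisfying the covariance relation, and counting the compatible ones *)

Section CovariantMatrix.
Variables (R : realType) (n : nat) (G : {group {perm 'I_n}}).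
Variable nu : {perm 'I_n} -> {ffun 'I_n -> R}.
Hypothesis hG : [transitive^2 G, on [set: 'I_n]%SET | 'P].
Hypothesis n2 : (2 <= n)%N.
Hypothesis nu_sign : {in G, forall s, is_sign_vector (nu s)}.

(** The relation of compatible matrices without any condition on the entries, so that it also
    applies to matrices of projections. *)
Definition covariant (C : 'M[R]_n) :=
  forall s i j, s \in G -> C (s i) (s j) = nu s i * nu s j * C i j.

(** The points 0 and 1 serve as a reference pair: by 2-transitivity its entry controls all
    off-diagonal ones. *)
Let i0 : 'I_n := Ordinal (ltnW n2).
Let j0 : 'I_n := Ordinal n2.
Let ij0 : i0 != j0. Proof. by []. Qed.

Lemma nu_sqr s i : s \in G -> nu s i * nu s i = 1.
Proof. by move=> sG; case: (nu_sign sG i) => ->; rewrite ?mulrNN mulr1. Qed.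

Lemma covariant_diag C : covariant C -> forall i, C i i = C i0 i0.
Proof.
move=> hC i; have [s sG <-] := ntransitive_exists hG i0 i.
by rewrite hC // nu_sqr // mul1r.
Qed.

Lemma covariant_offdiag C : covariant C ->
  forall i j, i != j -> C i j = C i0 j0 \/ C i j = - C i0 j0.
Proof.
move=> hC i j ij.
have [s [sG <- <-]] := ntransitive2_exists hG ij0 ij.
rewrite hC //.
by case: (nu_sign sG i0) => ->; case: (nu_sign sG j0) => ->;
  rewrite ?mulrNN ?mulN1r ?mulrN ?mulr1 ?mul1r ?mulNr ?mul1r; [left|right|right|left].
Qed.

Lemma compatible_opp A : compatible_matrix G nu A -> compatible_matrix G nu (- A).
Proof.
case=> h1 h2 h3 h4; split=> [|i|i j ij|s i j sG].
- by rewrite raddfN /= h1.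
- by rewrite mxE h2 oppr0.
- by rewrite mxE; case: (h3 _ _ ij) => ->; rewrite ?opprK; tauto.
- by rewrite !mxE h4 // mulrN.
Qed.

Lemma compatible_offdiag_neq0 A i j :
  compatible_matrix G nu A -> i != j -> A i j != 0.
Proof. by case=> _ _ h _ /h[] ->; rewrite ?oppr_eq0 oner_eq0. Qed.

(** At the reference pair both entries are signs, so they differ by a factor [c] equal to 1 or -1;
    covariance spreads this factor to every off-diagonal entry. *)
Lemma compatible_eq_opp A B : compatible_matrix G nu A ->
  compatible_matrix G nu B -> B = A \/ B = - A.
Proof.
move=> [A1 A2 A3 A4] [B1 B2 B3 B4].
have key c : B i0 j0 = c * A i0 j0 -> B = c *: A.
  move=> h; apply/matrixP=> i j; rewrite mxE.
  have [->|ij] := eqVneq i j; first by rewrite A2 B2 mulr0.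
  have [s [sG <- <-]] := ntransitive2_exists hG ij0 ij.
  by rewrite A4 // B4 // h mulrCA.
have : B i0 j0 = 1 * A i0 j0 \/ B i0 j0 = (-1) * A i0 j0.
  by case: (A3 _ _ ij0) => ->; case: (B3 _ _ ij0) => ->;
    rewrite ?mulN1r ?mul1r ?opprK; [left|right|right|left].
by case=> /key ->; [left; rewrite scale1r|right; rewrite scaleN1r].
Qed.

Lemma compatible_neq_opp A : compatible_matrix G nu A -> - A != A.
Proof.
move=> hA; apply/eqP => /matrixP/(_ i0 j0); rewrite mxE => /eqP.
by rewrite eqNr (negPf (compatible_offdiag_neq0 hA ij0)).
Qed.

Lemma compatible_setD1 A : compatible_matrix G nu A ->
  [set B | compatible_matrix G nu B] `\ A = [set - A].
Proof.
move=> hA; apply/seteqP; split=> [B [/= hB nBA]|_ ->].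
  by case: (compatible_eq_opp hA hB) => // /nBA.
by split; [apply: compatible_opp|apply/eqP/compatible_neq_opp].
Qed.

Lemma card_compatible :
  [set A | compatible_matrix G nu A] #= `I_0 \/
  [set A | compatible_matrix G nu A] #= `I_2.
Proof.
have [->|/set0P[A hA]] := eqVneq [set A | compatible_matrix G nu A] set0.
  by left; rewrite II0.
right; apply/eq_cardSP; exists A => //.
by rewrite compatible_setD1 // card_set1.
Qed.

(* By 2-transitivity a covariant matrix has constant diagonal [a] and
   off-diagonal entries [±b], so rescaling [C - a] gives a compatible matrix
   unless [b = 0]. *)
Lemma covariant_decomp C : C^T = C -> covariant C ->
  (exists a, C = a%:M) \/
  (exists a b A, compatible_matrix G nu A /\ C = a%:M + b *: A).
Proof.
move=> Csym hC; set a := C i0 i0; set b := C i0 j0.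
have Cd i : C i i = a by apply: covariant_diag.
have Co i j : i != j -> C i j = b \/ C i j = - b by apply: covariant_offdiag.
have [b0|b0] := eqVneq b 0.
  left; exists a; apply/matrixP=> i j; rewrite mxE.
  have [->|ij] := eqVneq i j; first by rewrite Cd.
  by case: (Co _ _ ij) => ->; rewrite b0 ?oppr0.
right; exists a, b, (b^-1 *: (C - a%:M)); split; last first.
  by rewrite scalerA mulfV // scale1r addrC subrK.
split=> [|i|i j ij|s i j sG].
- by rewrite linearZ linearB /= Csym tr_scalar_mx.
- by rewrite !mxE Cd eqxx subrr mulr0.
- rewrite !mxE (negPf ij) subr0.
  by case: (Co _ _ ij) => ->; rewrite ?mulrN mulVf //; tauto.
(* Subtracting [a] keeps covariance: on the diagonal the sign factor is a square, hence 1. *)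
- rewrite !mxE hC // (inj_eq perm_inj); have [->|ij] := eqVneq i j.
    by rewrite nu_sqr // !mul1r.
  by rewrite !subr0 mulrCA.
Qed.

(** The compatible matrix given by [covariant_decomp] is [A] or [- A], and the sign is absorbed into
    [b]. *)
Lemma covariant_sub_compatible C A : C^T = C -> covariant C ->
  compatible_matrix G nu A -> exists a b, C = a%:M + b *: A.
Proof.
move=> Csym hC hA; case: (covariant_decomp Csym hC) => [[a ->]|[a [b [B [hB ->]]]]].
  by exists a, 0; rewrite scale0r addr0.
case: (compatible_eq_opp hA hB) => ->; first by exists a, b.
by exists a, (- b); rewrite scalerN scaleNr.
Qed.

End CovariantMatrix.

(** * The endomorphism attached to a matrix, in coordinates *)

Section MatrixEndomorphism.
Variables (R : realType) (n : nat) (E : vectType R) (e : n.-tuple E).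
Hypothesis he : basis_of {:E} e.

Lemma coord_tnth i j : coord e i (tnth e j) = (i == j)%:R.
Proof. by rewrite (tnth_nth 0) coord_free ?(basis_free he) // eq_sym. Qed.

Lemma tnth_basis_sum u : u = \sum_i coord e i u *: tnth e i.
Proof.
rewrite {1}(coord_basis he (memvf u)).
by apply: eq_bigr => i _; rewrite (tnth_nth 0).
Qed.

Lemma lfun_basis_eq (V : vectType R) (f g : 'Hom(E, V)) :
  (forall j, f (tnth e j) = g (tnth e j)) -> f = g.
Proof.
move=> fg; apply/lfunP=> u; rewrite (tnth_basis_sum u) !linear_sum.
by apply: eq_bigr => i _; rewrite !linearZ /= fg.
Qed.

Lemma coord_mx_endo A u i :
  coord e i (mx_endo e A u) = \sum_j A i j * coord e j u.
Proof.
rewrite lfunE /= /mx_endo_fun linear_sum /=; apply: eq_bigr => j _.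
rewrite linearZ linear_sum /= (bigD1 i) //= big1 ?addr0 => [|k ki].
  by rewrite linearZ /= coord_tnth eqxx mulr1 mulrC.
by rewrite linearZ /= coord_tnth eq_sym (negPf ki) mulr0.
Qed.

Lemma mx_endo_scalarDZ a b A :
  mx_endo e (a%:M + b *: A) = a *: \1%VF + b *: mx_endo e A.
Proof.
apply: lfun_basis_eq => j; rewrite add_lfunE !scale_lfunE id_lfunE !mx_endoE //.
rewrite [X in _ = a *: X + _](tnth_basis_sum (tnth e j)) !scaler_sumr.
rewrite -big_split /=; apply: eq_bigr => i _.
by rewrite !mxE coord_tnth !scalerA -scalerDl mulr_natr.
Qed.

Lemma mem_leigenspace (f : 'End(E)) a u :
  (u \in passmx.leigenspace f a) = (f u == a *: u).
Proof.
by rewrite memv_ker add_lfunE opp_lfunE scale_lfunE id_lfunE subr_eq0.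
Qed.

(** [eigenvalue] refers to row vectors multiplied by [A] on the right, while [mx_endo] acts on
    columns; symmetry of [A] identifies the two. *)
Lemma eigenvalue_mx_endo A a : A^T = A ->
  eigenvalue A a = (passmx.leigenspace (mx_endo e A) a != 0%VS).
Proof.
move=> Asym.
have coord_eq u w : (forall i, coord e i u = coord e i w) -> u = w.
  by move=> uw; rewrite (tnth_basis_sum u) (tnth_basis_sum w);
    apply: eq_bigr => i _; rewrite uw.
apply/eigenvalueP/idP => [[v vA v0]|].
  pose u := \sum_i v 0 i *: tnth e i.
  have uE i : coord e i u = v 0 i.
    rewrite linear_sum (bigD1 i) //= linearZ /= coord_tnth eqxx mulr1.
    rewrite big1 ?addr0 // => k ki.
    by rewrite linearZ /= coord_tnth eq_sym (negPf ki) mulr0.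
  apply: contraNneq v0 => leig0.
  have : u \in passmx.leigenspace (mx_endo e A) a.
    rewrite mem_leigenspace; apply/eqP/coord_eq => i.
    rewrite coord_mx_endo linearZ /= uE.
    have /rowP/(_ i) := vA; rewrite !mxE => <-.
    by apply: eq_bigr => j _; rewrite uE -{1}Asym mxE mulrC.
  rewrite leig0 memv0 => /eqP u0; apply/eqP/rowP=> i.
  by rewrite -uE u0 linear0 mxE.
rewrite -vpick0; set u := vpick _ => u0.
have /eqP uA : mx_endo e A u == a *: u by rewrite -mem_leigenspace memv_pick.
exists (\row_i coord e i u); last first.
  apply: contraNneq u0 => /rowP c0; apply/eqP/coord_eq => i.
  by have := c0 i; rewrite !mxE linear0.
apply/rowP=> i; rewrite !mxE.
transitivity (coord e i (mx_endo e A u)); last by rewrite uA linearZ.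
rewrite coord_mx_endo.
by apply: eq_bigr => j _; rewrite -{1}Asym !mxE mulrC.
Qed.

End MatrixEndomorphism.

(** * Stable subspaces and the representations they carry *)

Section StableSubspaces.
Variables (R : realType) (n : nat) (G : {group {perm 'I_n}}) (E : vectType R).
Variable rho : {perm 'I_n} -> 'End(E).
Hypothesis rho_lin : linear_repr G rho.

Lemma reprKV s u : s \in G -> rho s (rho s^-1%g u) = u.
Proof.
case: rho_lin => h1 hM sG.
by rewrite -comp_lfunE -hM ?groupV // /perm_comp mulVg h1 id_lfunE.
Qed.

Lemma mem_stable (W : {vspace E}) s u :
  stable_subspace G rho W -> s \in G -> u \in W -> rho s u \in W.
Proof. by move=> hW sG uW; apply: (subvP (hW s sG)); apply: memv_img. Qed.

Section SubRepr.
Variable W : {vspace E}.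
Hypothesis W_stable : stable_subspace G rho W.

Lemma vsval_sub_repr s (y : subvs_of W) :
  s \in G -> vsval (sub_repr rho W s y) = rho s (vsval y).
Proof.
move=> sG; rewrite /sub_repr !comp_lfunE !lfunE /= vsprojK //.
by apply: mem_stable => //; apply: subvsP.
Qed.

Lemma linear_sub_repr : linear_repr G (sub_repr rho W).
Proof.
case: rho_lin => h1 hM; split=> [|s t sG tG]; apply/lfunP=> y; apply: val_inj => /=.
  by rewrite vsval_sub_repr // h1 !id_lfunE.
rewrite comp_lfunE !vsval_sub_repr // ?hM ?comp_lfunE //.
by rewrite /perm_comp groupM.
Qed.

(** The inclusion of [W] into [E] carries stable subspaces of the restriction to stable subspaces of
    [E] inside [W], so minimality of [W] can be tested in [E]. *)
Lemma irreducible_sub_repr : W != 0%VS ->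
  (forall U, stable_subspace G rho U -> (U <= W)%VS -> U = 0%VS \/ U = W) ->
  irreducible_repr G (sub_repr rho W).
Proof.
move=> W0 hmin; split.
  by rewrite dimvf /= lt0n dimv_eq0.
move=> U' hU'; pose f : 'Hom(subvs_of W, E) := linfun vsval.
have fE y : f y = vsval y by rewrite lfunE.
have hS : stable_subspace G rho (f @: U')%VS.
  move=> s sG; apply/subvP=> _ /memv_imgP[_ /memv_imgP[y yU' ->] ->].
  rewrite fE -vsval_sub_repr // -fE; apply: memv_img.
  exact: (subvP (hU' s sG)) _ (memv_img _ yU').
have hW : (f @: U' <= W)%VS.
  by apply/subvP=> _ /memv_imgP[y _ ->]; rewrite fE subvsP.
have [fU0|fUW] := hmin _ hS hW; [left|right].
  apply/eqP; rewrite -subv0; apply/subvP=> y yU'.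
  have : f y \in (f @: U')%VS by apply: memv_img.
  by rewrite fU0 !memv0 fE => /eqP y0; apply/eqP/val_inj.
apply/eqP; rewrite eqEsubv subvf; apply/subvP=> y _.
have : vsval y \in (f @: U')%VS by rewrite fUW subvsP.
by case/memv_imgP=> z zU'; rewrite fE => /val_inj ->.
Qed.

End SubRepr.
End StableSubspaces.

(** * The monomial representation: isometry, projections and eigenspaces *)

Section MonomialRepresentation.
Variables (R : realType) (n : nat) (G : {group {perm 'I_n}}).
Variable nu : {perm 'I_n} -> {ffun 'I_n -> R}.
Hypothesis hG : [transitive^2 G, on [set: 'I_n]%SET | 'P].
Hypothesis n2 : (2 <= n)%N.
Hypothesis nu_sign : {in G, forall s, is_sign_vector (nu s)}.
Variables (E : vectType R) (dot : {dot E for idfun}) (e : n.-tuple E).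
Hypothesis he : basis_of {:E} e.
Hypothesis heo : orthonormal dot e.
Variable rho : {perm 'I_n} -> 'End(E).
Hypothesis rho_lin : linear_repr G rho.
Hypothesis rhoE : forall s j, s \in G -> rho s (tnth e j) = nu s j *: tnth e (s j).

Lemma dot_tnth i j : dot (tnth e i) (tnth e j) = (i == j)%:R.
Proof. by rewrite !(tnth_nth 0) orthonormal_nth ?size_tuple. Qed.

Lemma tnth_perm s j : s \in G -> tnth e (s j) = nu s j *: rho s (tnth e j).
Proof. by move=> sG; rewrite rhoE // scalerA (nu_sqr nu_sign) // scale1r. Qed.

Lemma monomial_isometry s u v : s \in G -> dot (rho s u) (rho s v) = dot u v.
Proof.
move=> sG.
have hb i j :
      dot (rho s (tnth e i)) (rho s (tnth e j)) = dot (tnth e i) (tnth e j).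
  rewrite !rhoE // linearZ /= dotC linearZ /= dotC !dot_tnth (inj_eq perm_inj).
  have [->|ij] := eqVneq i j; last by rewrite !mulr0.
  by rewrite mulr1 (nu_sqr nu_sign).
(* The identity on basis vectors is extended by linearity one argument at a time. *)
have hr i w : dot (rho s (tnth e i)) (rho s w) = dot (tnth e i) w.
  rewrite (tnth_basis_sum he w) !linear_sum; apply: eq_bigr => j _.
  by rewrite linearZ /= !linearZ /= hb.
rewrite dotC [RHS]dotC (tnth_basis_sum he u) !linear_sum.
by apply: eq_bigr => i _; rewrite linearZ /= !linearZ /= dotC hr [in RHS]dotC.
Qed.

(** By isometry, [rho s] on one side of [dot] becomes [rho s^-1] on the other, where it preserves
    [U]. *)
Lemma stable_orthov U :
  stable_subspace G rho U -> stable_subspace G rho (orthov dot U).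
Proof.
move=> hU s sG; apply/subvP=> _ /memv_imgP[w /mem_orthovP wU ->].
apply/mem_orthovP=> v vU.
rewrite -(reprKV rho_lin v sG).
transitivity (dot w (rho s^-1%g v)); first exact: monomial_isometry.
by apply: wU; apply: (mem_stable hU) => //; rewrite groupV.
Qed.

Lemma orthoproj_repr U s u : stable_subspace G rho U -> s \in G ->
  orthoproj dot U (rho s u) = rho s (orthoproj dot U u).
Proof.
move=> hU sG; apply: orthoproj_unique.
  by apply: (mem_stable hU) => //; apply: memv_orthoproj.
rewrite -linearB; apply: (mem_stable (stable_orthov hU)) => //.
exact: orthoproj_residue.
Qed.

(** Since [e] is orthonormal, these inner products are the coordinates of the projected basis
    vectors; this form makes symmetry and covariance direct. *)
Definition orthoproj_mx U : 'M[R]_n :=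
  \matrix_(i, j) dot (orthoproj dot U (tnth e j)) (tnth e i).

Lemma orthoproj_mxK U : mx_endo e (orthoproj_mx U) = orthoproj dot U.
Proof.
apply: (lfun_basis_eq he) => j; rewrite mx_endoE // [RHS](tnth_basis_sum he).
apply: eq_bigr => i _; congr (_ *: _); rewrite mxE dotC.
rewrite [in LHS](tnth_basis_sum he (orthoproj _ _ _)) linear_sum /= (bigD1 i) //=.
rewrite linearZ /= dot_tnth eqxx mulr1 big1 ?addr0 // => k ki.
by rewrite linearZ /= dot_tnth eq_sym (negPf ki) mulr0.
Qed.

Lemma orthoproj_mx_sym U : (orthoproj_mx U)^T = orthoproj_mx U.
Proof. by apply/matrixP=> i j; rewrite !mxE orthoproj_sym dotC. Qed.

(** Up to sign, the basis vectors at [s i] and [s j] are images under [rho s], which commutes with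
    the projection and cancels by isometry. *)
Lemma orthoproj_mx_covariant U :
  stable_subspace G rho U -> covariant G nu (orthoproj_mx U).
Proof.
move=> hU s i j sG; rewrite !mxE !tnth_perm // !linearZ /= orthoproj_repr //.
by rewrite dotC linearZ /= dotC monomial_isometry // mulrA.
Qed.

(** A nonzero vector of [U] is fixed by the projection, which forces [a = 1]; then every vector lies
    in [U]. *)
Lemma orthoproj_scalar U a :
  orthoproj_mx U = a%:M -> U = 0%VS \/ U = fullv.
Proof.
move=> h; have {}h u : orthoproj dot U u = a *: u.
  rewrite -orthoproj_mxK h -[a%:M]addr0 -[0](scale0r a%:M) mx_endo_scalarDZ //.
  by rewrite scale0r addr0 scale_lfunE id_lfunE.
have [->|U0] := eqVneq U 0%VS; [by left|right].
have := orthoproj_id dot (memv_pick U); rewrite h => /eqP.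
rewrite -subr_eq0 -{2}[vpick U]scale1r -scalerBl scaler_eq0 vpick0 (negPf U0) orbF.
rewrite subr_eq0 => /eqP a1.
apply/eqP; rewrite eqEsubv subvf; apply/subvP=> u _.
by rewrite -[u]scale1r -a1 -h memv_orthoproj.
Qed.

Lemma orthoproj_affine U A : stable_subspace G rho U -> compatible_matrix G nu A ->
  exists a b, orthoproj_mx U = a%:M + b *: A /\
    forall u, orthoproj dot U u = a *: u + b *: mx_endo e A u.
Proof.
move=> hU hA.
have [a [b h]] := covariant_sub_compatible hG n2 nu_sign
  (orthoproj_mx_sym U) (orthoproj_mx_covariant hU) hA.
exists a, b; split=> // u.
by rewrite -orthoproj_mxK h mx_endo_scalarDZ // add_lfunE !scale_lfunE id_lfunE.
Qed.

Lemma doubly_transitive_sub_repr W : stable_subspace G rho W -> W != 0%VS ->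
  doubly_transitive_repr G (sub_repr rho W).
Proof.
move=> hW W0; split; first exact: linear_sub_repr.
pose p i := orthoproj dot W (tnth e i).
have pW i : p i \in W by apply: memv_orthoproj.
have pE s i : s \in G -> rho s (p i) = nu s i *: p (s i).
  by move=> sG; rewrite -orthoproj_repr // rhoE // linearZ.
have nu0 s i : s \in G -> nu s i != 0.
  by move=> sG; case: (nu_sign sG i) => ->; rewrite ?oppr_eq0 oner_eq0.
(* A vector of [W] is its own projection, so projecting its expansion in [e] expresses it through
   the [p i]. *)
have span_p u : u \in W -> u = \sum_i coord e i u *: p i.
  move=> uW; rewrite -{1}(orthoproj_id dot uW) {1}(tnth_basis_sum he u) linear_sum.
  by apply: eq_bigr => i _; rewrite linearZ.
exists (fun i => vsproj W (p i)); split.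
- move=> i; apply/eqP => pi0.
  have {}pi0 : p i = 0 by rewrite -(vsprojK (pW i)) pi0.
  (* Transitivity spreads the vanishing of one [p i] to all of them, which would make [W] zero. *)
  have p0 j : p j = 0.
    have [s sG <-] := ntransitive_exists hG i j.
    apply/eqP; have := pE s i sG; rewrite pi0 linear0 => /esym/eqP.
    by rewrite scaler_eq0 (negPf (nu0 _ _ sG)).
  case/eqP: W0; apply/eqP; rewrite -subv0; apply/subvP=> u /span_p ->.
  by rewrite big1 ?mem0v // => k _; rewrite p0 scaler0.
- apply/eqP; rewrite eqEsubv subvf; apply/subvP=> y _.
  rewrite -(vsvalK y) (span_p _ (subvsP y)) linear_sum; apply: memv_suml => i _.
  rewrite linearZ; apply/memvZ/memv_span/map_f.
  by rewrite mem_enum.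
- move=> s i sG.
  have -> : sub_repr rho W s (vsproj W (p i)) = nu s i *: vsproj W (p (s i)).
    by apply: val_inj; rewrite /= (vsval_sub_repr hW _ sG) !vsprojK ?pE.
  apply/eqP; rewrite eqEsubv -!memvE memvZ ?memv_line //=.
  by rewrite -[X in X \in _](scalerK (nu0 s i sG)) memvZ ?memv_line.
Qed.

(** The projection onto a stable [U] inside [W] is affine in [A], hence acts on [W] as the scalar
    [a + b * x]. If [U] is nonzero this scalar is 1, so [W] lies in [U]. *)
Lemma irreducible_leigenspace A x (W := passmx.leigenspace (mx_endo e A) x) :
  compatible_matrix G nu A -> stable_subspace G rho W -> W != 0%VS ->
  irreducible_repr G (sub_repr rho W).
Proof.
move=> hA hW W0; apply: irreducible_sub_repr => // U hU UW.
have [a [b [_ h]]] := orthoproj_affine hU hA.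
have {}h u : u \in W -> orthoproj dot U u = (a + b * x) *: u.
  by rewrite mem_leigenspace => /eqP uW; rewrite h uW scalerA scalerDl.
have [->|U0] := eqVneq U 0%VS; [by left|right].
have := orthoproj_id dot (memv_pick U).
rewrite h ?(subvP UW) ?memv_pick // => /eqP.
rewrite -subr_eq0 -{2}[vpick U]scale1r -scalerBl scaler_eq0 vpick0 (negPf U0) orbF.
rewrite subr_eq0 => /eqP c1.
apply/eqP; rewrite eqEsubv UW; apply/subvP=> u uW.
by rewrite -[u]scale1r -c1 -h // memv_orthoproj.
Qed.

End MonomialRepresentation.

(** * Construction of the representation from the homomorphism [J] *)

Section MonomialExistence.
Variables (R : realType) (n : nat) (G : {group {perm 'I_n}}).
Variable J : {perm 'I_n} -> {perm 'I_n} * {ffun 'I_n -> R}.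
Hypothesis hJ : semidirect_morphism G J.
Hypothesis hJ1 : forall s, s \in G -> (J s).1 = s.
Let nu s := (J s).2.

Lemma semidirect_sign : {in G, forall s, is_sign_vector (nu s)}.
Proof. by move=> s sG; have [/(_ s sG)[]] := hJ. Qed.

Lemma semidirect_cocycle s t j : s \in G -> t \in G ->
  nu (perm_comp s t) j = nu s (t j) * nu t j.
Proof. by move=> sG tG; rewrite /nu (hJ.2 s t sG tG) ffunE /= hJ1. Qed.

(** The cocycle identity at the neutral element makes this sign equal to its own square. *)
Lemma semidirect_nu1 j : nu 1%g j = 1.
Proof.
have := semidirect_cocycle j (group1 G) (group1 G).
rewrite /perm_comp mulg1 perm1.
by have [->|->] := semidirect_sign (group1 G) j; rewrite ?mulrNN mulr1.
Qed.

Variables (E : vectType R) (e : n.-tuple E).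
Hypothesis he : basis_of {:E} e.

Definition monomial_repr (s : {perm 'I_n}) : 'End(E) :=
  mx_endo e (\matrix_(i, j) ((i == s j)%:R * nu s j)).

Lemma monomial_reprE s j : monomial_repr s (tnth e j) = nu s j *: tnth e (s j).
Proof.
rewrite /monomial_repr mx_endoE // (bigD1 (s j)) //= mxE eqxx mul1r.
by rewrite big1 ?addr0 // => i ij; rewrite mxE (negPf ij) mul0r scale0r.
Qed.

Lemma monomial_repr_linear : linear_repr G monomial_repr.
Proof.
split=> [|s t sG tG]; apply: (lfun_basis_eq he) => j.
  by rewrite monomial_reprE semidirect_nu1 perm1 scale1r id_lfunE.
rewrite comp_lfunE !monomial_reprE linearZ /= monomial_reprE scalerA.
by rewrite semidirect_cocycle // mulrC /perm_comp permM.
Qed.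

End MonomialExistence.

(** * Assembly: existence and uniqueness of [rho], the count, and the reducible case *)

Theorem mainTheorem1 (R : realType) (n : nat) (hn : (2 <= n)%N)
    (G : {group {perm 'I_n}}) (hG : [transitive^2 G, on [set: 'I_n]%SET | 'P])
    (E : vectType R) (dotE : {dot E for idfun}) (e : n.-tuple E)
    (he : basis_of {:E} e) (heo : orthonormal dotE e)
    (J : {perm 'I_n} -> {perm 'I_n} * {ffun 'I_n -> R})
    (hJ : semidirect_morphism G J)
    (hJ1 : forall s, s \in G -> (J s).1 = s) :
  let nu s := (J s).2 in
  let is_rho (rho : {perm 'I_n} -> 'End(E)) :=
    linear_repr G rho /\
    (forall s j, s \in G -> rho s (tnth e j) = nu s j *: tnth e (s j)) in
  let compatible := [set A : 'M[R]_n | compatible_matrix G nu A] in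
  [/\ exists rho, is_rho rho /\
        (forall rho', is_rho rho' -> {in G, rho' =1 rho}),
      (compatible #= `I_0 \/ compatible #= `I_2) /\
        (forall A, compatible A -> compatible `\ A = [set - A])
    & forall rho, is_rho rho -> ~ irreducible_repr G rho ->
        (exists A, compatible A) /\
        (forall A, compatible A ->
          exists lambda1 lambda2 : R,
            [/\ lambda1 != lambda2,
                forall a, eigenvalue A a <-> a = lambda1 \/ a = lambda2
              & forall a, a = lambda1 \/ a = lambda2 ->
                  let U := passmx.leigenspace (mx_endo e A) a in
                  [/\ stable_subspace G rho U,
                      irreducible_repr G (sub_repr rho U)
                    & doubly_transitive_repr G (sub_repr rho U)]])].
Proof.
move=> nu is_rho compatible.
have nu_sign : {in G, forall s, is_sign_vector (nu s)} by exact: semidirect_sign.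
split.
- exists (monomial_repr J e); split.
    split; first exact: monomial_repr_linear.
    by move=> s j _; apply: monomial_reprE.
  move=> rho' [_ rho'E] s sG; apply: (lfun_basis_eq he) => j.
  by rewrite rho'E // monomial_reprE.
- split; first exact: card_compatible.
  by move=> A hA; apply: compatible_setD1.
move=> rho [rho_lin rhoE] hred.
have [U [U_stable U0 UT]] : exists U : {vspace E},
    [/\ stable_subspace G rho U, U != 0%VS & U != fullv].
  apply: contrapT => noU; apply: hred; split.
    (* Irreducibility could also fail because [E] is zero; a basis of [n >= 2] vectors excludes
       this. *)
    rewrite lt0n dimv_eq0; apply: contraTneq hn => E0.
    have := size_basis he; rewrite E0 dimv0 => n0.
    by rewrite -n0.
  move=> U hU; apply: contrapT => /not_orP[/eqP U0 /eqP UT].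
  by apply: noU; exists U.
have not_scalar a : orthoproj_mx dotE e U <> a%:M.
  move=> /(orthoproj_scalar he heo)[/eqP|/eqP].
    by rewrite (negPf U0).
  by rewrite (negPf UT).
have Pcov := orthoproj_mx_covariant nu_sign he heo rho_lin rhoE U_stable.
split.
  case: (covariant_decomp hG hn nu_sign (orthoproj_mx_sym _ _ _) Pcov).
    by move=> [a /not_scalar].
  by move=> [_ [_ [A [hA _]]]]; exists A.
move=> A hA.
have [a [b [PC PE]]] :=
  orthoproj_affine hG hn nu_sign he heo rho_lin rhoE U_stable hA.
have b0 : b != 0.
  by apply/eqP=> b0; apply: (not_scalar a); rewrite PC b0 scale0r addr0.
set P := orthoproj dotE U in PE.
(* As [A = (P - a) / b], the eigenvalue [c] of [P] corresponds to [(c - a) / b] for [A]; the values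
   [c = 1] and [c = 0] give [U] and its orthogonal complement. *)
have eigE c u :
    (u \in passmx.leigenspace (mx_endo e A) ((c - a) / b)) = (P u == c *: u).
  rewrite mem_leigenspace PE -(inj_eq (scalerI b0)) scalerA mulrCA mulfV // mulr1.
  by rewrite scalerBl eq_sym subr_eq eq_sym addrC.
have eig1 : passmx.leigenspace (mx_endo e A) ((1 - a) / b) = U.
  apply/vspaceP=> u; rewrite eigE scale1r; apply/eqP/idP => [<-|].
    exact: memv_orthoproj.
  exact: orthoproj_id.
have eig0 : passmx.leigenspace (mx_endo e A) ((0 - a) / b) = orthov dotE U.
  apply/vspaceP=> u; rewrite eigE scale0r; apply/eqP/idP => [P0|uU].
    by have := orthoproj_residue dotE U u; rewrite -/P P0 subr0.
  by apply: orthoproj_unique; rewrite ?mem0v ?subr0.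
have orth0 : orthov dotE U != 0%VS.
  apply: contraNneq UT => o0; have := addv_orthov dotE U.
  by rewrite o0 addv0 => ->.
have key x : x = (1 - a) / b \/ x = (0 - a) / b ->
    stable_subspace G rho (passmx.leigenspace (mx_endo e A) x) /\
    passmx.leigenspace (mx_endo e A) x != 0%VS.
  case=> ->; rewrite ?eig1 ?eig0; split=> //.
  exact: (stable_orthov nu_sign he heo rho_lin rhoE).
exists ((1 - a) / b), ((0 - a) / b); split.
- by rewrite (inj_eq (mulIf (invr_neq0 b0))) (inj_eq (addIr _)) oner_eq0.
- move=> x; have [Asym _ _ _] := hA; rewrite (eigenvalue_mx_endo he) //.
  split=> [|/key[]//]; rewrite -vpick0; set u := vpick _ => u0.
  (* No other eigenvalue occurs: [x] for [A] yields [a + b * x] for [P], and idempotence of [P]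
     forces this to be 0 or 1. *)
  have xE : x = (a + b * x - a) / b by rewrite addrC addKr mulrC mulKf.
  have uP : P u = (a + b * x) *: u.
    by apply/eqP; rewrite -eigE -xE memv_pick.
  have : P (P u) = P u by apply/orthoproj_id/memv_orthoproj.
  rewrite uP linearZ /= uP => /(congr1 (fun w => w - (a + b * x) *: u)) /eqP.
  rewrite subrr -scalerBr -[X in _ - X]scale1r -scalerBl scalerA scaler_eq0.
  rewrite (negPf u0) orbF mulf_eq0 subr_eq0 => /orP[] /eqP cE.
    by right; rewrite xE cE.
  by left; rewrite xE cE.
- move=> x /key[W_stable W0] /=; split=> //.
    exact: (irreducible_leigenspace hG hn nu_sign he heo rho_lin rhoE).
  exact: (doubly_transitive_sub_repr hG nu_sign he heo rho_lin rhoE).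
Qed.
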